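(* Let $C_1,C_2,C_3,C_4$ be four circles in the Euclidean plane whose Pedoe vectors $\mathbf{C}_1,\dots,\mathbf{C}_4\in\mathbb{R}^4$ are linearly independent. Let $A=[\mathbf{C}_1\mid\mathbf{C}_2\mid\mathbf{C}_3\mid\mathbf{C}_4]$ be the $4\times4$ matrix whose columns are these vectors, and let $f$ be the configuration matrix, $f_{ij}=\langle \mathbf{C}_i,\mathbf{C}_j\rangle$. Then, with $F=f^{-1}$ and $G=g^{-1}$, $$A\,F\,A^{T}=G .$$
   Context: On $\mathbb{R}^4$ let $\langle \mathbf v,\mathbf w\rangle=\mathbf v^T g\,\mathbf w=\tfrac12 v_1w_2+\tfrac12 v_2w_1-v_3w_3-v_4w_4$, where $$g=\begin{bmatrix}0&\tfrac12&0&0\\ \tfrac12&0&0&0\\0&0&-1&0\\0&0&0&-1\end{bmatrix},\qquad G=g^{-1}=\begin{bmatrix}0&2&0&0\\2&0&0&0\\0&0&-1&0\\0&0&0&-1\end{bmatrix}.$$ The Pedoe vector of the circle of radius $r>0$ with center $(x,y)\in\mathbb{R}^2$ is $$\mathbf{C}=\left[\tfrac1r,\ \tfrac{x^2+y^2-r^2}{r},\ \tfrac{x}{r},\ \tfrac{y}{r}\right]^T .$$ Its entries are called the curvature, the co-curvature, and the two reduced position coordinates of the circle. Circles are called linearly independent if their Pedoe vectors are. *)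

(* Defs.v *)
From mathcomp Require Import all_boot all_order all_algebra.
From mathcomp Require Import reals.

Set Implicit Arguments.
Unset Strict Implicit.
Unset Printing Implicit Defensive.

Import Order.TTheory GRing.Theory Num.Theory.
Local Open Scope ring_scope.

Record circle (R : realType) := Circle {
  center_x : R;
  center_y : R;
  radius : R;
  radius_gt0 : 0 < radius }.

Definition pedoe (R : realType) (C : circle R) : 'cV[R]_4 :=
  let x := center_x C in let y := center_y C in let r := radius C in
  \col_(i < 4) [:: r^-1; (x ^+ 2 + y ^+ 2 - r ^+ 2) / r; x / r; y / r]`_i.

Definition gmx (R : realType) : 'M[R]_4 :=
  \matrix_(i < 4, j < 4)
    (nth [::] [:: [:: 0;    2^-1; 0;   0  ];
                  [:: 2^-1; 0;    0;   0  ];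
                  [:: 0;    0;    - 1; 0  ];
                  [:: 0;    0;    0;   - 1]] i)`_j.

(* [invmx] returns its argument on singular matrices; [gmx_unit] and [GmxE] below
   show that this is the genuine inverse. *)
Definition Gmx (R : realType) : 'M[R]_4 := invmx (gmx R).

Definition pedoe_form (R : realType) (v w : 'cV[R]_4) : R :=
  (v^T *m gmx R *m w) 0 0.

Lemma pedoe_formE (R : realType) (v w : 'cV[R]_4) :
  pedoe_form v w =
    2^-1 * v 0 0 * w 1 0 + 2^-1 * v 1 0 * w 0 0
    - v 2%:R 0 * w 2%:R 0 - v 3%:R 0 * w 3%:R 0.
Proof.
rewrite /pedoe_form !mxE !big_ord_recl big_ord0 !mxE.
rewrite !big_ord_recl !big_ord0 !mxE /=.
rewrite !(mulr0, addr0, add0r, mulrN1, mulNr).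
rewrite [_ * 2^-1]mulrC [v 0 0 * _]mulrC.
rewrite (_ : lift ord0 ord0 = 1 :> 'I_4); last exact: val_inj.
rewrite (_ : lift ord0 (lift ord0 ord0) = 2%:R :> 'I_4); last exact: val_inj.
rewrite (_ : lift ord0 (lift ord0 (lift ord0 ord0)) = 3%:R :> 'I_4);
  last exact: val_inj.
by rewrite addrCA !addrA.
Qed.

Lemma gmx_mul (R : realType) :
  gmx R *m (\matrix_(i < 4, j < 4)
    (nth [::] [:: [:: 0; 2; 0;   0  ];
                  [:: 2; 0; 0;   0  ];
                  [:: 0; 0; - 1; 0  ];
                  [:: 0; 0; 0;   - 1]] i)`_j) = 1%:M.
Proof.
have h : 2^-1 * 2 = 1 :> R by rewrite mulVf // pnatr_eq0.
apply/matrixP=> i j; rewrite !mxE !big_ord_recl big_ord0 !mxE /=.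
by case: i => -[|[|[|[|//]]]] ?; case: j => -[|[|[|[|//]]]] ? /=;
  rewrite !(mulr0, mul0r, addr0, add0r, mulrNN, mulr1, h).
Qed.

Lemma gmx_unit (R : realType) : gmx R \in unitmx.
Proof. by case: (mulmx1_unit (gmx_mul R)). Qed.

Lemma GmxE (R : realType) :
  Gmx R = \matrix_(i < 4, j < 4)
    (nth [::] [:: [:: 0; 2; 0;   0  ];
                  [:: 2; 0; 0;   0  ];
                  [:: 0; 0; - 1; 0  ];
                  [:: 0; 0; 0;   - 1]] i)`_j.
Proof. by rewrite /Gmx -[LHS]mulmx1 -(gmx_mul R) mulKmx ?gmx_unit. Qed.

Definition lin_indep_circles (R : realType) n (C : 'I_n -> circle R) : bool :=
  free [seq pedoe (C i) | i : 'I_n].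

Definition pedoe_mx (R : realType) n (C : 'I_n -> circle R) : 'M[R]_(4, n) :=
  \matrix_(i < 4, j < n) pedoe (C j) i 0.

Definition config_mx (R : realType) n (C : 'I_n -> circle R) : 'M[R]_n :=
  \matrix_(i < n, j < n) pedoe_form (pedoe (C i)) (pedoe (C j)).

(* Main.v *)
Require Import Defs.
From mathcomp Require Import all_boot all_order all_algebra.
From mathcomp Require Import reals.

Set Implicit Arguments.
Unset Strict Implicit.
Unset Printing Implicit Defensive.

Import Order.TTheory GRing.Theory Num.Theory.
Local Open Scope ring_scope.

(** The configuration matrix is the Gram matrix of the Pedoe vectors, so it
    factors as [f = A^T *m g *m A] ([config_mxE]). Linear independence of the
    four circles makes the square matrix [A] invertible
    ([row_free_tr_col_family]); hence so is [f], and inverting the factorization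
    gives [F = A^-1 *m G *m A^-T]. Multiplying by [A] on the left and by [A^T]
    on the right leaves [G] ([mulmx_inv_congruence]). *)

(** A linear relation among the vectors [u i] is a row vector annihilated by
    the transpose of the matrix that they form: freeness says that this row
    kernel is trivial. *)
Lemma row_free_tr_col_family (F : fieldType) m n (u : 'I_n -> 'cV[F]_m) :
  free [seq u i | i : 'I_n] -> row_free (\matrix_(i < m, j < n) u j i 0)^T.
Proof.
move=> free_u.
have {free_u} : free (map_tuple u (ord_tuple n)) by [].
move/freeP=> indep_u; rewrite -kermx_eq0; apply/rowV0P => v /sub_kermxP vA0.
apply/rowP => j; rewrite mxE; apply: (indep_u (fun i => v 0 i)).
apply/colP => i; move/rowP/(_ i): vA0; rewrite !mxE summxE => vA0.
rewrite -[RHS]vA0; apply: eq_bigr => k _.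
by rewrite (nth_map k) ?size_tuple // -tnth_nth tnth_ord_tuple !mxE.
Qed.

Lemma config_mxE (R : realType) n (C : 'I_n -> circle R) :
  config_mx C = (pedoe_mx C)^T *m gmx R *m pedoe_mx C.
Proof.
apply/matrixP => i j; rewrite mxE /pedoe_form !mxE; apply: eq_bigr => k _.
rewrite [pedoe_mx C k j]mxE; congr (_ * _).
by rewrite !mxE; apply: eq_bigr => l _; rewrite !mxE.
Qed.

Lemma mulmx_inv_congruence (R : comUnitRingType) n (A g : 'M[R]_n) :
    A \in unitmx -> g \in unitmx ->
  A^T *m g *m A \in unitmx /\ A *m invmx (A^T *m g *m A) *m A^T = invmx g.
Proof.
move=> uA ug; have uAT : A^T \in unitmx by rewrite unitmx_tr.
have uf : A^T *m g *m A \in unitmx by rewrite !unitmx_mul uAT ug uA.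
split=> //.
(* Multiplying by [g] and then [A^T] on the left completes the product
   [A^T *m g *m A], which cancels its inverse. *)
apply: (can_inj (mulKmx ug)); rewrite mulmxV //.
apply: (can_inj (mulKmx uAT)).
by rewrite mulmx1 !mulmxA mulmxV // mul1mx.
Qed.

Theorem theorem3p1 (R : realType) (C : 'I_4 -> circle R)
    (indepC : lin_indep_circles C) :
  let A := pedoe_mx C in
  let f := config_mx C in
  f \in unitmx /\ A *m invmx f *m A^T = Gmx R.
Proof.
rewrite /= config_mxE; apply: mulmx_inv_congruence (gmx_unit R).
by rewrite -unitmx_tr -row_free_unit; apply: row_free_tr_col_family.
Qed.
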